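(* Let $\nu_0$ be a probability measure on $[0,1]$ with $\nu_0((\frac12,1])>0$. Then there exists $k\in\mathbb{N}$ such that the following holds whenever $W>1$ and $(W-1)/\sigma_W$ (with $\sigma_W>0$) are large enough: if $\tilde\nu_0$ is the probability measure on pairs $(p,\varepsilon)$ whose $p$-marginal is $\nu_0$ and whose conditional law of $\varepsilon$ given $p$ is the Gaussian $\mathcal{N}(0,\sigma_W^2)$ truncated to the interval $(a(p),b(p))$ with $a(p)=-(W-1)p$, $b(p)=(W-1)(1-p)$, and $\mu$ is any probability measure on $([0,1]\times\mathbb{R})^{\mathbb{N}}$ with $\mu\ll\mu_0:=\prod_{n=1}^\infty\tilde\nu_0$, then $\mu(\mathcal{C}_I^w)=1$.
   Context: For a sequence $((p_i,\varepsilon_i))_{i=1}^\infty$ define weights $w_i:=1+(W-1)p_i^k+\varepsilon_i$ (so $w_i\in[1,W]$ under the truncation above). Let $X_1,X_2,\dots$ be independent random variables with values in $\{-1,+1\}$ and $\mathbb{P}(X_i=1)=p_i$. $\mathcal{C}_I^w$ is the set of sequences $((p_i,\varepsilon_i))_{i=1}^\infty$ for which the weighted Condorcet Jury Property holds: $\lim_{n\to\infty}\mathbb{P}\left(\sum_{i=1}^n w_iX_i>0\right)=1$. $\mu\ll\mu_0$ denotes absolute continuity. *)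

(* Defs.v *)
From HB Require Import structures.
From mathcomp Require Import all_boot all_order all_algebra.
From mathcomp Require Import all_classical all_reals all_analysis.
Set Implicit Arguments. Unset Strict Implicit. Unset Printing Implicit Defensive.
Import Order.TTheory GRing.Theory Num.Theory.
Import numFieldNormedType.Exports.
Local Open Scope classical_set_scope.
Local Open Scope ring_scope.

Section defs.
Variable R : realType.

(* Generators of the product sigma-algebra on ([0,1] x R)^N (realised on
   (R x R)^N): preimages of Borel rectangles under a single coordinate. *)
Definition coord_rects : set (set (nat -> R * R)) :=
  [set C | exists (i : nat) (A B : set R), measurable A /\ measurable B /\
      C = [set x | A (x i).1 /\ B (x i).2]].

Definition SeqSpace := g_sigma_algebraType coord_rects.

Definition trunc_normal (sigma a b : R) (B : set R) : R :=
  fine (normal_prob 0 sigma (B `&` `]a, b[)) / fine (normal_prob 0 sigma `]a, b[).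

Definition tr_a (W p : R) : R := - ((W - 1) * p).
Definition tr_b (W p : R) : R := (W - 1) * (1 - p).

Definition nu_tilde (nu0 : probability R R) (W sigma : R) (A B : set R) : \bar R :=
  (\int[nu0]_(p in A) (trunc_normal sigma (tr_a W p) (tr_b W p) B)%:E)%E.

(* mu0 is the infinite product measure prod_n nu0tilde: it agrees with the
   product of the marginals on all finite-dimensional measurable rectangles
   (this determines mu0 uniquely on the product sigma-algebra). *)
Definition is_product_measure (nu0 : probability R R) (W sigma : R)
    (mu0 : probability SeqSpace R) : Prop :=
  forall (n : nat) (A B : nat -> set R),
    (forall i, measurable (A i) /\ measurable (B i)) ->
    mu0 [set x : SeqSpace | forall i, (i < n)%N -> A i (x i).1 /\ B i (x i).2]
    = (\prod_(i < n) nu_tilde nu0 W sigma (A i) (B i))%E.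

Definition weight (W : R) (k : nat) (pe : R * R) : R :=
  1 + (W - 1) * pe.1 ^+ k + pe.2.

(* P(sum_{i<n} w_i X_i > 0) for independent X_i in {-1,+1} with
   P(X_i = 1) = p_i, written as the sum over outcomes of the product law. *)
Definition vote_prob (W : R) (k : nat) (x : nat -> R * R) (n : nat) : R :=
  \sum_(s : {ffun 'I_n -> bool} |
          0 < \sum_(i < n) weight W k (x i) * (if s i then 1 else -1))
    \prod_(i < n) (if s i then (x i).1 else 1 - (x i).1).

Definition CJP_set (W : R) (k : nat) : set SeqSpace :=
  [set x | (vote_prob W k x n) @[n --> \oo] --> (1 : R)].

End defs.

(* Main.v *)
Require Import Defs.
From mathcomp Require Import all_boot all_order all_algebra.
From mathcomp Require Import all_classical all_reals all_analysis.
From mathcomp Require Import measurable_realfun ring lra.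
Set Implicit Arguments.
Unset Strict Implicit.
Unset Printing Implicit Defensive.
Import Order.TTheory GRing.Theory Num.Theory.
Import numFieldNormedType.Exports.
Local Open Scope classical_set_scope.
Local Open Scope ring_scope.

(** Chernoff's bound with parameter t estimates the probability of a wrong
    outcome by the product over the voters of
    p exp(-tw) + (1 - p) exp(tw) <= 1 - t w (2p - 1) + 2 (tw)^2.
    Choose h > 1/2 with nu0 [h, +oo[ > 0 and label each voter by whether p >= h
    and whether |e| > 2^-k (W - 1).  The drift w (2p - 1) is bounded below by a
    function of the label: up to a bounded term, competent voters gain
    (2h - 1) h^k (W - 1), incompetent ones lose at most 2^-k (W - 1), and the
    noise costs at most 2^-k (W - 1) unless it exceeds its threshold.  Large k
    makes h^k win over 2^-k; large W and (W - 1) / sigma make the bounded term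
    negligible and large noise improbable.  The drift bound then has positive
    mean, and for small t the Chernoff factor computed from it has mean rho < 1.
    The labels are i.i.d., so the expected probability of a wrong outcome is at
    most rho^n; being summable in n, it forces this probability to tend to 0
    almost surely. *)

Section weighted_vote.
Context {R : realType} {n : nat}.
Variables p w : 'I_n -> R.
Implicit Types (s : {ffun 'I_n -> bool}) (t : R).

Definition outcome_prob s : R := \prod_(i < n) (if s i then p i else 1 - p i).

Definition weighted_sum s : R := \sum_(i < n) w i * (if s i then 1 else -1).

Definition vote_mgf t : R :=
  \prod_(i < n) (p i * expR (- (t * w i)) + (1 - p i) * expR (t * w i)).

Lemma sum_ffun_bool_prod (a b : 'I_n -> R) :
  \sum_(s : {ffun 'I_n -> bool}) \prod_(i < n) (if s i then a i else b i)
  = \prod_(i < n) (a i + b i).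
Proof.
under [RHS]eq_bigr => i _.
  rewrite -(big_bool _ (fun c : bool => if c then a i else b i)); over.
by rewrite bigA_distr_bigA.
Qed.

Lemma sum_outcome_prob : \sum_s outcome_prob s = 1.
Proof. by rewrite sum_ffun_bool_prod big1// => i _; rewrite addrC subrK. Qed.

Lemma sum_outcome_prob_expR t :
  \sum_s outcome_prob s * expR (- (t * weighted_sum s)) = vote_mgf t.
Proof.
rewrite /vote_mgf -sum_ffun_bool_prod; apply: eq_bigr => s _.
rewrite mulr_sumr -sumrN expR_sum -big_split; apply: eq_bigr => i _.
by case: (s i); rewrite ?mulr1 ?mulrN1 ?mulrN ?opprK.
Qed.

Hypothesis p01 : forall i, 0 <= p i <= 1.

Lemma outcome_prob_ge0 s : 0 <= outcome_prob s.
Proof.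
apply: prodr_ge0 => i _; have /andP[p0 p1] := p01 i.
by case: (s i); rewrite ?subr_ge0.
Qed.

Lemma weighted_sum_chernoff t : 0 <= t ->
  \sum_(s | ~~ (0 < weighted_sum s)) outcome_prob s <= vote_mgf t.
Proof.
move=> t0; rewrite -sum_outcome_prob_expR.
rewrite [leRHS](bigID (fun s => ~~ (0 < weighted_sum s))) /=.
apply: ler_wpDr.
  by apply: sumr_ge0 => s _; rewrite mulr_ge0 ?expR_ge0 ?outcome_prob_ge0.
apply: ler_sum => s; rewrite -leNgt => s_le0.
rewrite ler_peMr ?outcome_prob_ge0// -expR0 ler_expR oppr_ge0.
exact: mulr_ge0_le0.
Qed.

End weighted_vote.

Section chernoff.
Variable R : realType.
Implicit Types (p t u v M W : R) (k n : nat) (x : nat -> R * R).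

Lemma expR_le_quadratic u : u <= 2^-1 -> expR u <= 1 + u + 2 * u ^+ 2.
Proof.
move=> u_le; have exp_le : expR u * (1 - u) <= 1.
  rewrite -[leRHS](expRxMexpNx_1 u) ler_pM2l ?expR_gt0//.
  exact: expR_ge1Dx.
have : 0 <= u ^+ 2 * (1 - 2 * u) by rewrite mulr_ge0 ?sqr_ge0//; lra.
have -> : u ^+ 2 * (1 - 2 * u) = (1 + u + 2 * u ^+ 2) * (1 - u) - 1 by ring.
by move=> sq_ge0; rewrite -(@ler_pM2r _ (1 - u)); lra.
Qed.

Lemma two_point_mgf_le p v : 0 <= p <= 1 -> `|v| <= 2^-1 ->
  p * expR (- v) + (1 - p) * expR v <= 1 - v * (2 * p - 1) + 2 * v ^+ 2.
Proof.
move=> /andP[p0 p1]; rewrite ler_norml => /andP[v_ge v_le].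
have up : (1 - p) * expR v <= (1 - p) * (1 + v + 2 * v ^+ 2).
  by rewrite ler_wpM2l ?subr_ge0 ?expR_le_quadratic.
have down : p * expR (- v) <= p * (1 - v + 2 * v ^+ 2).
  by rewrite -[in leRHS](sqrrN v) ler_wpM2l// expR_le_quadratic//; lra.
lra.
Qed.

Lemma vote_probE W k x n : vote_prob W k x n
  = 1 - \sum_(s | ~~ (0 < weighted_sum (fun i : 'I_n => weight W k (x i)) s))
          outcome_prob (fun i : 'I_n => (x i).1) s.
Proof.
apply/eqP; rewrite eq_sym subr_eq -(sum_outcome_prob (fun i : 'I_n => (x i).1)).
by rewrite [eqbLHS](bigID (fun s => 0 < weighted_sum (weight W k \o x) s)).
Qed.

Lemma vote_prob_le1 W k x n : (forall i, 0 <= (x i).1 <= 1) ->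
  vote_prob W k x n <= 1.
Proof.
move=> x01; rewrite vote_probE gerBl.
by apply: sumr_ge0 => s _; exact: outcome_prob_ge0.
Qed.

Definition chernoff_factor t M r : R := 1 - t * r + 2 * (t * M) ^+ 2.

Lemma chernoff_factor_ge0 t M r : 0 <= t -> t * M <= 1 -> r <= M ->
  0 <= chernoff_factor t M r.
Proof.
move=> t0 tM rM; have tr : t * r <= t * M by rewrite ler_wpM2l.
have := sqr_ge0 (t * M); rewrite /chernoff_factor; lra.
Qed.

Definition voter_drift_bounds W k M r (pe : R * R) : Prop :=
  [/\ 0 <= pe.1 <= 1, `|weight W k pe| <= M
    & r <= weight W k pe * (2 * pe.1 - 1)].

Lemma voter_mgf_le W k t M r pe : 0 <= t -> t * M <= 2^-1 ->
    voter_drift_bounds W k M r pe ->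
  pe.1 * expR (- (t * weight W k pe)) + (1 - pe.1) * expR (t * weight W k pe)
  <= chernoff_factor t M r.
Proof.
move=> t0 tM [p01 wM r_le]; set w := weight W k pe in wM r_le *.
have twM : `|t * w| <= t * M by rewrite normrM ger0_norm// ler_wpM2l.
apply: (le_trans (two_point_mgf_le p01 (le_trans twM tM))).
have : (t * w) ^+ 2 <= (t * M) ^+ 2.
  by rewrite -(real_normK (num_real (t * w))) lerXn2r// nnegrE (le_trans _ twM).
have : t * r <= t * (w * (2 * pe.1 - 1)) by rewrite ler_wpM2l.
rewrite /chernoff_factor -mulrA; lra.
Qed.

Lemma vote_prob_ge W k t M (r : nat -> R) x n : 0 <= t -> t * M <= 2^-1 ->
    (forall i, voter_drift_bounds W k M (r i) (x i)) ->
  1 - \prod_(i < n) chernoff_factor t M (r i) <= vote_prob W k x n.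
Proof.
move=> t0 tM xM; have p01 i : 0 <= (x i).1 <= 1 by have [] := xM i.
rewrite vote_probE lerD2l lerN2.
apply: (le_trans (weighted_sum_chernoff _ _ t0)) => //.
apply: ler_prod => i _; have /andP[p0 p1] := p01 i.
by rewrite addr_ge0 ?mulr_ge0 ?expR_ge0 ?subr_ge0//=; exact: voter_mgf_le.
Qed.

End chernoff.

Lemma expr_unbounded (R : realType) (a M : R) : 1 < a ->
  exists2 k : nat, (0 < k)%N & M <= a ^+ k.
Proof.
move=> a1; have a0 : 0 < a := lt_trans ltr01 a1.
have inva1 : `|a^-1| < 1 by rewrite gtr0_norm ?invf_lt1 ?invr_gt0.
have M0 : 0 < (`|M| + 1)^-1 by rewrite invr_gt0 ltr_wpDl.
have small : \forall k \near \oo, a^-1 ^+ k < (`|M| + 1)^-1.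
  exact: (cvgr_lt _ (cvg_expr inva1)).
have [k [k_small k0]] := filter_ex (filterI small (nbhs_infty_gt 0)).
exists k => //; move: k_small.
rewrite exprVn ltf_pV2 ?posrE ?exprn_gt0 ?ltr_wpDl//.
by have := ler_norm M; lra.
Qed.

Lemma nneseries_expr_lty (R : realType) (rho : R) : 0 <= rho < 1 ->
  (\sum_(n <oo) (rho ^+ n)%:E < +oo)%E.
Proof.
move=> /andP[rho0 rho1].
have cv : cvgn (series (geometric 1 rho)).
  by apply: is_cvg_geometric_series; rewrite ger0_norm.
rewrite (_ : (fun n => _) = EFin \o series (geometric 1 rho)).
  by rewrite EFin_lim ?ltry.
apply/funext => n; rewrite sumEFin/=.
by congr EFin; apply: eq_bigr => i _; rewrite /geometric/= mul1r.
Qed.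

Section summable_means.
Context d (T : measurableType d) (R : realType).
Variable mu : {measure set T -> \bar R}.
Implicit Types f : nat -> T -> R.

Lemma ae_cvg0_nneseries f :
    (forall n, measurable_fun setT (f n)) -> (forall n x, 0 <= f n x) ->
    (\sum_(n <oo) \int[mu]_x (f n x)%:E < +oo)%E ->
  {ae mu, forall x, f n x @[n --> \oo] --> (0 : R)}.
Proof.
move=> mf f0 sum_lty; have mEf n : measurable_fun setT (EFin \o f n).
  exact/measurable_EFinP.
pose F x : \bar R := (\sum_(n <oo) (f n x)%:E)%E.
have F0 x : (0 <= F x)%E by apply: nneseries_ge0 => *; rewrite lee_fin.
have intF : mu.-integrable setT F.
  apply/integrableP; split.
    apply: ge0_emeasurable_sum => [n x _ _|n _]; last exact: mEf.
    by rewrite lee_fin.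
  under eq_integral do rewrite gee0_abs//.
  by rewrite integral_nneseries// => n x _; rewrite lee_fin.
have := integrable_ae measurableT intF; apply: filterS => x /(_ I) Fx.
apply: cvg_series_cvg_0; apply: nondecreasing_is_cvgn.
  exact: nondecreasing_series.
exists (fine (F x)) => _ [n _ <-]; rewrite -lee_fin fineK// /series/= -sumEFin.
by apply: nneseries_lim_ge => i *; rewrite lee_fin.
Qed.

End summable_means.

(* The integral of a nonnegative function is a supremum over simple functions,
   so no measurability is needed; this spares proving that [trunc_normal]
   depends measurably on [p]. *)
Lemma ge0_le_integral_nonmeasurable d (T : measurableType d) (R : realType)
    (mu : {measure set T -> \bar R}) (D : set T) (f g : T -> \bar R) :
  (forall x, D x -> (0 <= f x)%E) -> (forall x, D x -> (f x <= g x)%E) ->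
  (\int[mu]_(x in D) f x <= \int[mu]_(x in D) g x)%E.
Proof.
move=> f0 fg; have g0 x : D x -> (0 <= g x)%E.
  by move=> Dx; apply: le_trans (fg x Dx); exact: f0.
rewrite !ge0_integralE//; apply: ereal_sup_le.
move=> _ [s /= sf <-]; exists s => // x.
exact: le_trans (sf x) (lee_restrict fg x).
Qed.

Lemma measurable_cvg_to d (T : measurableType d) (R : realType)
    (f : nat -> T -> R) (l : R) :
  (forall n, measurable_fun setT (f n)) ->
  measurable [set x | f n x @[n --> \oo] --> l].
Proof.
move=> mf; pose dist n x := `|f n x - l|%:E.
rewrite (_ : [set _ | _] = [set x | (limn_esup (dist ^~ x) <= 0)%E]).
  rewrite -[X in measurable X]setTI; apply: measurable_lee => //.
  apply: measurable_fun_limn_esup => n; apply/measurable_EFinP.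
  by apply: measurableT_comp => //; exact: measurable_funB.
have distE x : (dist n x @[n --> \oo] --> 0%E) <-> (f n x @[n --> \oo] --> l).
  split=> [/fine_cvgP[_ dist0]|fl]; first exact/subr_cvg0/norm_cvg0P.
  by apply/fine_cvgP; split; [exact: nearW|exact/norm_cvg0P/subr_cvg0].
apply/seteqP; split => x /=.
  move/distE => dist0; rewrite is_cvg_limn_esupE; last first.
    by apply/cvg_ex; exists 0%E.
  by rewrite (cvg_lim _ dist0).
by move=> le0; apply/distE/limn_esup_le_cvg => // n; rewrite lee_fin.
Qed.

Lemma measure_itv_oc_gt0 (R : realType) (mu : {measure set R -> \bar R})
    (a b : R) : (0 < mu `]a, b]%classic)%E ->
  exists2 h, a < h <= b & (0 < mu `[h, +oo[%classic)%E.
Proof.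
rewrite measure_gt0 => /eqP mu_gt0; apply: contrapT => none; apply: mu_gt0.
apply/negligibleP => //; rewrite itv_open_bnd_bigcup.
apply: negligible_bigcup => n; set h := a + n.+1%:R^-1.
apply/negligibleP => //.
have [hb|bh] := leP h b; last first.
  by rewrite set_itv_ge -?ltNge ?bnd_simp ?measure0// leNgt bh.
apply/eqP; rewrite -measure_le0 leNgt; apply/negP => mu_h; apply: none.
exists h; first by rewrite hb ltrDl invr_gt0 ltr0n.
apply: (lt_le_trans mu_h); rewrite le_measure ?inE//.
by apply: subset_itvl; rewrite bnd_simp.
Qed.

Definition measurable_fibers d (T : measurableType d) (K : Type) (z : T -> K) :
  Prop := forall j, measurable (z @^-1` [set j]).

Lemma measurable_fibers_bool d (T : measurableType d) (f : T -> bool) :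
  measurable_fun setT f -> measurable_fibers f.
Proof. by move=> mf b; rewrite -[X in measurable X]setTI; exact: mf. Qed.

Section finite_valued.
Context d (T : measurableType d) (R : realType) (P : probability T R).
Context (J : finType).
Implicit Types (z : T -> J) (g : J -> R).

Definition law z j : R := fine (P (z @^-1` [set j])).

Lemma law_ge0 z j : 0 <= law z j. Proof. exact: fine_ge0. Qed.

Lemma EFin_law z j : measurable_fibers z -> (law z j)%:E = P (z @^-1` [set j]).
Proof. by move=> mz; rewrite fineK ?fin_num_measure. Qed.

Lemma measurable_preimage_fibers z (A : set J) :
  measurable_fibers z -> measurable (z @^-1` A).
Proof.
move=> mz; rewrite (_ : _ @^-1` _ = \bigcup_(j in A) z @^-1` [set j]).
  by apply: fin_bigcup_measurable; [exact: finite_finset|move=> j _; exact: mz].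
by apply/seteqP; split => [x Ax|x [j Aj] /= ->//]; exists (z x).
Qed.

Lemma measurable_fun_fibers z g : measurable_fibers z ->
  measurable_fun setT (g \o z).
Proof.
move=> mz _ B _; rewrite setTI comp_preimage.
exact: measurable_preimage_fibers.
Qed.

Lemma ge0_integral_law z g : measurable_fibers z -> (forall j, 0 <= g j) ->
  (\int[P]_x (g (z x))%:E = (\sum_j g j * law z j)%:E)%E.
Proof.
move=> mz g0.
have gzE x : g (z x) = \sum_j g j * \1_(z @^-1` [set j]) x.
  rewrite (bigD1 (z x))//= indicE mem_set// mulr1 big1 ?addr0// => j jz.
  by rewrite indicE memNset ?mulr0//= => zj; rewrite zj eqxx in jz.
under eq_integral do rewrite gzE -sumEFin.
rewrite ge0_integral_sum//; last 2 first.
- by move=> j; apply/measurable_EFinP; exact: measurable_funM.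
- by move=> j x _; rewrite lee_fin mulr_ge0.
rewrite -sumEFin; apply: eq_bigr => j _; under eq_integral do rewrite EFinM.
rewrite ge0_integralZl ?integral_indic ?setIT ?lee_fin//.
  by rewrite EFinM EFin_law.
by apply/measurable_EFinP.
Qed.

Lemma sum_law_pred z (a : pred J) : measurable_fibers z ->
  \sum_(j | a j) law z j = fine (P [set x | a (z x)]).
Proof.
move=> mz; have ma : measurable [set x | a (z x)].
  exact: (measurable_preimage_fibers [set` a]).
rewrite -[in RHS](setIT [set x | _]) -integral_indic//.
rewrite (_ : \1__ = fun x => (a (z x))%:R); last first.
  apply/funext => x; rewrite indicE.
  by have [ax|/negP ax] := boolP (a (z x)); [rewrite mem_set|rewrite memNset].
rewrite (ge0_integral_law (g := fun j => (a j)%:R))// big_mkcond.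
by apply: eq_bigr => j _; case: (a j); rewrite ?mul1r ?mul0r.
Qed.

Lemma sum_law z : measurable_fibers z -> \sum_j law z j = 1.
Proof.
by move=> mz; rewrite (sum_law_pred predT mz) /= set_true probability_setT.
Qed.

End finite_valued.

Section independent_labels.
Context d (T : measurableType d) (R : realType) (P : probability T R).
Context (J : finType).
Implicit Types (Z : nat -> T -> J) (g : J -> R).

Definition iid Z : Prop := forall n (f : nat -> J),
  P [set x | forall i, (i < n)%N -> Z i x = f i]
  = (\prod_(i < n) P (Z 0%N @^-1` [set f i]))%E.

Lemma integral_prod_iid Z g n : (forall i, measurable_fibers (Z i)) -> iid Z ->
    (forall j, 0 <= g j) ->
  (\int[P]_x (\prod_(i < n) g (Z i x))%:E
   = ((\sum_j g j * law P (Z 0%N) j) ^+ n)%:E)%E.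
Proof.
move=> mZ iidZ g0; case: n => [|n].
  under eq_integral do rewrite big_ord0.
  by rewrite integral_cst//= probability_setT mule1.
pose z x : {ffun 'I_n.+1 -> J} := [ffun i => Z (val i) x].
have zE f : z @^-1` [set f] =
    [set x | forall i, (i < n.+1)%N -> Z i x = f (inord i)].
  apply/seteqP; split => x /=.
    by move=> <- i i_lt; rewrite ffunE /= inordK.
  by move=> Zf; apply/ffunP => i; rewrite ffunE Zf ?inord_val ?ltn_ord.
have mz f : measurable (z @^-1` [set f]).
  rewrite zE (_ : [set x | _] = \bigcap_(i in [set i | (i < n.+1)%N])
    Z i @^-1` [set f (inord i)])//.
  by apply: bigcap_measurableType => i _; exact: mZ.
have lawzE f : law P z f = \prod_i law P (Z 0%N) (f i).
  apply: EFin_inj; rewrite EFin_law// zE iidZ -prodEFin.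
  by apply: eq_bigr => i _; rewrite EFin_law// inord_val.
under eq_integral => x _.
  rewrite (_ : \prod_(i < n.+1) _ = \prod_i g (z x i)); last first.
    by apply: eq_bigr => i _; rewrite ffunE.
  over.
pose G (f : {ffun 'I_n.+1 -> J}) := \prod_i g (f i).
rewrite (ge0_integral_law _ mz (g := G)); last by move=> f; exact: prodr_ge0.
congr EFin; rewrite -[X in _ ^+ X](card_ord n.+1) -prodr_const.
by rewrite bigA_distr_bigA/=; apply: eq_bigr => f _; rewrite lawzE big_split.
Qed.

Lemma ae_prod_iid_cvg0 Z g : (forall i, measurable_fibers (Z i)) -> iid Z ->
    (forall j, 0 <= g j) -> \sum_j g j * law P (Z 0%N) j < 1 ->
  {ae P, forall x, \prod_(i < n) g (Z i x) @[n --> \oo] --> (0 : R)}.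
Proof.
move=> mZ iidZ g0 mean_lt1.
apply: (ae_cvg0_nneseries (f := fun n x => \prod_(i < n) g (Z i x))).
- by move=> n; apply: measurable_prod => i _; exact: measurable_fun_fibers.
- by move=> n x; exact: prodr_ge0.
- under eq_eseriesr do rewrite (integral_prod_iid _ mZ)//.
  apply: nneseries_expr_lty; rewrite mean_lt1 andbT.
  by apply: sumr_ge0 => j _; rewrite mulr_ge0// law_ge0.
Qed.

End independent_labels.

Section labelled_jury.
Context d (T : measurableType d) (R : realType) (P : probability T R).
Context (J : finType) (Z : nat -> T -> J) (drift : J -> R).
Context (x : T -> nat -> R * R) (W M : R) (k : nat).
Hypotheses (mZ : forall i, measurable_fibers (Z i)) (iidZ : iid P Z).
Hypothesis drift_le : forall j, drift j <= M.

(* The choice t = m / (4 M ^ 2) minimises 1 - t m + 2 (t M) ^ 2, the mean of the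
   Chernoff factor when m is the mean drift. *)
Lemma mean_chernoff_factor_lt1 : 0 < \sum_j drift j * law P (Z 0%N) j ->
  exists2 t, 0 <= t /\ t * M <= 2^-1 &
    \sum_j chernoff_factor t M (drift j) * law P (Z 0%N) j < 1.
Proof.
set m := \sum_j _ => m0.
have mM : m <= M.
  rewrite -[leRHS]mulr1 -(sum_law P (mZ 0%N)) mulr_sumr; apply: ler_sum => j _.
  by rewrite ler_wpM2r// law_ge0.
have M0 : 0 < M := lt_le_trans m0 mM.
pose t := m / (4 * M ^+ 2); exists t.
  split; first by rewrite divr_ge0 ?(ltW m0)// mulr_ge0 ?sqr_ge0.
  have -> : t * M = m / (4 * M) by rewrite /t; field; rewrite gt_eqF.
  by rewrite ler_pdivrMr ?mulr_gt0//; lra.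
rewrite (eq_bigr (fun j => law P (Z 0%N) j * (1 + 2 * (t * M) ^+ 2)
    - t * (drift j * law P (Z 0%N) j))); last first.
  by move=> j _; rewrite /chernoff_factor; ring.
rewrite sumrB -mulr_suml -mulr_sumr sum_law// -/m mul1r.
have tm0 : 0 < t * m by rewrite !mulr_gt0// invr_gt0 mulr_gt0// exprn_gt0.
have -> : 2 * (t * M) ^+ 2 = t * m / 2 by rewrite /t; field; rewrite gt_eqF.
lra.
Qed.

Lemma ae_vote_prob_cvg1 :
    {ae P, forall omega i,
      voter_drift_bounds W k M (drift (Z i omega)) (x omega i)} ->
    0 < \sum_j drift j * law P (Z 0%N) j ->
  {ae P, forall omega, vote_prob W k (x omega) n @[n --> \oo] --> (1 : R)}.
Proof.
move=> bounded /mean_chernoff_factor_lt1[t [t0 tM] mean_lt1].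
pose g j := chernoff_factor t M (drift j).
have g0 j : 0 <= g j.
  by apply: chernoff_factor_ge0 => //; lra.
apply: filterS2 (ae_prod_iid_cvg0 mZ iidZ g0 mean_lt1) bounded.
move=> omega prod_cvg0 xM.
apply: (@squeeze_cvgr _ _ _ _
  (fun n => 1 - \prod_(i < n) g (Z i omega)) (fun=> 1)).
- apply: nearW => n; rewrite /= [X in X && _](vote_prob_ge _ t0 tM xM)/=.
  by apply: vote_prob_le1 => i; have [] := xM i.
- by rewrite -[X in _ --> X]subr0; apply: cvgB => //; exact: cvg_cst.
- exact: cvg_cst.
Qed.

End labelled_jury.

Section seq_space.
Variable R : realType.
Implicit Types (W : R) (k n i : nat) (A B : set R).

Lemma measurable_rectangle i A B : measurable A -> measurable B ->
  measurable [set x : SeqSpace R | A (x i).1 /\ B (x i).2].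
Proof. by move=> mA mB; apply: sub_sigma_algebra; exists i, A, B. Qed.

Lemma measurable_judge_event i A : measurable A ->
  measurable [set x : SeqSpace R | A (x i).1].
Proof.
move=> mA; rewrite (_ : [set x | _] = [set x | A (x i).1 /\ setT (x i).2]).
  exact: measurable_rectangle.
by apply/seteqP; split => x //= -[].
Qed.

Lemma measurable_noise_event i B : measurable B ->
  measurable [set x : SeqSpace R | B (x i).2].
Proof.
move=> mB; rewrite (_ : [set x | _] = [set x | setT (x i).1 /\ B (x i).2]).
  exact: measurable_rectangle.
by apply/seteqP; split => x //= -[].
Qed.

Lemma measurable_judge i :
  measurable_fun [set: SeqSpace R] (fun x : SeqSpace R => (x i).1).
Proof. by move=> _ A mA; rewrite setTI; exact: measurable_judge_event. Qed.

Lemma measurable_noise i :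
  measurable_fun [set: SeqSpace R] (fun x : SeqSpace R => (x i).2).
Proof. by move=> _ B mB; rewrite setTI; exact: measurable_noise_event. Qed.

Lemma measurable_weight W k i :
  measurable_fun [set: SeqSpace R] (fun x : SeqSpace R => weight W k (x i)).
Proof.
apply: measurable_funD; last exact: measurable_noise.
apply: measurable_funD => //; apply: measurable_funM => //.
by apply: measurable_funX; exact: measurable_judge.
Qed.

Lemma measurable_vote_prob W k n :
  measurable_fun [set: SeqSpace R] (fun x : SeqSpace R => vote_prob W k x n).
Proof.
pose wsum (x : SeqSpace R) := weighted_sum (fun i : 'I_n => weight W k (x i)).
pose prob (x : SeqSpace R) := outcome_prob (fun i : 'I_n => (x i).1).
rewrite (_ : (fun x => _) =
    (fun x => \sum_s if 0 < wsum x s then prob x s else 0)); last first.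
  by apply/funext => x; rewrite -big_mkcond.
apply: measurable_sum => s; apply: measurable_fun_ifT => //.
  apply: measurable_fun_ltr => //; apply: measurable_sum => i.
  by apply: measurable_funM => //; exact: measurable_weight.
apply: measurable_prod => i _; case: (s i); first exact: measurable_judge.
by apply: measurable_funB => //; exact: measurable_judge.
Qed.

Lemma measurable_CJP_set W k : measurable (CJP_set (R := R) W k).
Proof. by apply: measurable_cvg_to => n; exact: measurable_vote_prob. Qed.

End seq_space.

Definition norm_tail {R : realType} (r : R) : set R := [set z | r < `|z|].

Lemma measurable_norm_tail {R : realType} (r : R) : measurable (norm_tail r).
Proof.
rewrite -[X in measurable X]setTI.
exact: (measurable_fun_ltr (measurable_cst r) (@normr_measurable R setT)).
Qed.

Section normal_density.
Variables (R : realType) (m sigma : R).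
Hypothesis sigma0 : 0 < sigma.
Implicit Types (a b c z r : R) (V : set R).

Lemma normal_pdf_gt0 z : 0 < normal_pdf m sigma z.
Proof.
by rewrite normal_pdfE ?gt_eqF// mulr_gt0 ?expR_gt0// normal_peak_gt0 ?gt_eqF.
Qed.

Lemma normal_pdf_le z r : `|z - m| <= `|r - m| ->
  normal_pdf m sigma r <= normal_pdf m sigma z.
Proof.
move=> zr; rewrite normal_pdfE ?gt_eqF// ler_pM2l ?normal_peak_gt0 ?gt_eqF//.
rewrite ler_expR ler_pM2r ?invr_gt0 ?pmulrn_lgt0 ?exprn_gt0// lerN2.
rewrite -(real_normK (num_real (z - m))) -(real_normK (num_real (r - m))).
by rewrite lerXn2r ?nnegrE.
Qed.

Let measurable_pdf V : measurable_fun V (fun z => (normal_pdf m sigma z)%:E).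
Proof.
by apply/measurable_EFinP/measurable_funTS; exact: measurable_normal_pdf.
Qed.

Lemma normal_prob_ge V c : measurable V -> 0 <= c ->
    (forall z, V z -> c <= normal_pdf m sigma z) ->
  (c%:E * lebesgue_measure V <= normal_prob m sigma V)%E.
Proof.
move=> mV c0 c_le; rewrite -integral_cst//=; apply: ge0_le_integral => //=.
exact: measurable_pdf.
Qed.

Lemma normal_prob_le V c : measurable V ->
    (forall z, V z -> normal_pdf m sigma z <= c) ->
  (normal_prob m sigma V <= c%:E * lebesgue_measure V)%E.
Proof.
move=> mV le_c; rewrite -integral_cst//=; apply: ge0_le_integral => //=.
- by move=> z _; rewrite lee_fin normal_pdf_ge0.
- exact: measurable_pdf.
Qed.

Lemma normal_prob_itv_gt0 a b : a < b -> (0 < normal_prob m sigma `]a, b[)%E.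
Proof.
move=> ab; pose r := `|a - m| + `|b - m|.
pose c := normal_pdf m sigma (m + r).
apply: lt_le_trans (normal_prob_ge (c := c) _ _ _) => //.
- rewrite lebesgue_measure_itv/= lte_fin ab -EFinM lte_fin mulr_gt0 ?subr_gt0//.
  exact: normal_pdf_gt0.
- exact: normal_pdf_ge0.
- move=> z /=; rewrite in_itv/= => /andP[az zb]; apply: normal_pdf_le.
  rewrite (addrC m) addrK [leRHS]ger0_norm ?addr_ge0// ler_norml.
  have := ler_norm (b - m); have := ler_norm (- (a - m)); rewrite normrN.
  have := normr_ge0 (a - m); have := normr_ge0 (b - m); rewrite /r; lra.
Qed.

End normal_density.

Section truncated_normal.
Variables (R : realType) (sigma : R).
Hypothesis sigma0 : 0 < sigma.
Implicit Types (a b r delta : R) (B : set R).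

Lemma trunc_normal_ge0 a b B : 0 <= trunc_normal sigma a b B.
Proof. by rewrite divr_ge0 ?fine_ge0. Qed.

Lemma fine_normal_prob_itv_gt0 a b : a < b ->
  0 < fine (normal_prob 0 sigma `]a, b[).
Proof.
by move=> ab; rewrite fine_gt0// normal_prob_itv_gt0//= ltey_eq fin_num_measure.
Qed.

Lemma trunc_normalT a b : a < b -> trunc_normal sigma a b setT = 1.
Proof.
move=> ab; rewrite /trunc_normal setTI divff// gt_eqF//.
exact: fine_normal_prob_itv_gt0.
Qed.

Lemma trunc_normal_disjoint a b B : B `&` `]a, b[ = set0 ->
  trunc_normal sigma a b B = 0.
Proof. by rewrite /trunc_normal => ->; rewrite measure0 mul0r. Qed.

Lemma normal_pdf_half r : normal_pdf 0 sigma r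
  = expR (- (3 / 8 * (r / sigma) ^+ 2)) * normal_pdf 0 sigma (r / 2).
Proof.
rewrite normal_pdfE ?gt_eqF// [RHS]mulrCA -expRD; congr (_ * expR _).
by rewrite !subr0; field; rewrite gt_eqF.
Qed.

Lemma normal_prob_tail_le a b r : a < b -> 0 <= r ->
  fine (normal_prob 0 sigma (norm_tail r `&` `]a, b[))
  <= (b - a) * normal_pdf 0 sigma r.
Proof.
move=> ab r0; have mV : measurable (norm_tail r `&` `]a, b[).
  by apply: measurableI => //; exact: measurable_norm_tail.
rewrite -lee_fin fineK ?fin_num_measure// mulrC EFinM.
apply: le_trans (normal_prob_le (c := normal_pdf 0 sigma r) mV _) _.
  move=> z [/= rz _]; apply: normal_pdf_le => //.
  by rewrite !subr0 (ger0_norm r0) ltW.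
rewrite lee_wpmul2l ?lee_fin ?normal_pdf_ge0//.
rewrite (_ : (b - a)%:E = lebesgue_measure `]a, b[%classic); last first.
  by rewrite lebesgue_measure_itv/= lte_fin ab.
by rewrite le_measure ?inE.
Qed.

(* Since [0] lies in [[a, b]], one of the two sides of [0] leaves room for an
   interval of length [r / 2] on which the density is at least its value at
   [r / 2]. *)
Lemma normal_prob_itv_ge a b r : a <= 0 <= b -> 0 < r <= b - a ->
  r / 2 * normal_pdf 0 sigma (r / 2) <= fine (normal_prob 0 sigma `]a, b[).
Proof.
move=> /andP[a0 b0] /andP[r0 rab]; set y := r / 2.
pose u := if y <= b then 0 else - y.
have ua : a <= u by rewrite /u; case: ifPn; rewrite -?ltNge /y; lra.
have ub : u + y <= b by rewrite /u; case: ifPn; rewrite -?ltNge /y; lra.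
have u0y : (u == 0) || (u == - y).
  by rewrite /u; case: ifP; rewrite eqxx ?orbT.
rewrite -lee_fin fineK ?fin_num_measure// mulrC EFinM.
apply: (@le_trans _ _ (normal_prob 0 sigma `]u, (u + y)[)); last first.
  by rewrite le_measure ?inE//; apply: subset_itv; rewrite bnd_simp.
rewrite (_ : y%:E = lebesgue_measure `]u, (u + y)[%classic).
  apply: normal_prob_ge => //; first exact: normal_pdf_ge0.
  move=> z /=; rewrite in_itv/= => zu; apply: normal_pdf_le => //.
  rewrite !subr0 [leRHS]gtr0_norm ?divr_gt0// ler_norml.
  by case/orP: u0y zu => /eqP ->; rewrite /y; lra.
rewrite lebesgue_measure_itv/= lte_fin ltrDl divr_gt0//.
by rewrite -EFinB [u + y]addrC addrK.
Qed.

Lemma trunc_normal_tail_le a b r : a <= 0 <= b -> 0 < r <= b - a ->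
  trunc_normal sigma a b (norm_tail r)
  <= 2 * (b - a) / r * expR (- (3 / 8 * (r / sigma) ^+ 2)).
Proof.
move=> ab0 rab; have /andP[r0 r_le] := rab.
have ab : a < b by rewrite -subr_gt0 (lt_le_trans r0).
rewrite ler_pdivrMr ?fine_normal_prob_itv_gt0//.
apply: (le_trans (normal_prob_tail_le ab (ltW r0))).
rewrite normal_pdf_half; set E := expR _.
set N := normal_pdf _ _ _.
have -> : (b - a) * (E * N) = 2 * (b - a) / r * E * (r / 2 * N).
  by field; rewrite gt_eqF.
rewrite ler_wpM2l ?normal_prob_itv_ge// mulr_ge0 ?expR_ge0//.
by rewrite divr_ge0 ?(ltW r0)// mulr_ge0// subr_ge0 ltW.
Qed.

Lemma trunc_normal_relative_tail_le a b delta : a <= 0 <= b -> a < b ->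
    0 < delta <= 1 -> 4 / delta ^+ 2 <= (b - a) / sigma ->
  trunc_normal sigma a b (norm_tail (delta * (b - a))) <= delta.
Proof.
move=> ab0 ab /andP[d0 d1]; set D := b - a; set s := D / sigma => big.
have D0 : 0 < D by rewrite subr_gt0.
apply: (le_trans (trunc_normal_tail_le ab0 _)).
  by rewrite mulr_gt0//= ler_piMl// ltW.
have -> : 2 * D / (delta * D) = 2 / delta by field; rewrite !gt_eqF.
have -> : delta * D / sigma = delta * s by rewrite mulrA.
rewrite expRN ler_pdivrMr ?expR_gt0// ler_pdivrMr// mulrAC -expr2.
apply: le_trans (ler_wpM2l (sqr_ge0 delta) (expR_ge1Dx _)).
have ds4 : 4 <= delta ^+ 2 * s by rewrite mulrC -ler_pdivrMr// exprn_gt0.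
have : 4 ^+ 2 <= (delta ^+ 2 * s) ^+ 2.
  by rewrite lerXn2r ?nnegrE// (le_trans _ ds4).
have := sqr_ge0 delta; rewrite !exprMn; lra.
Qed.

End truncated_normal.

Section product_marginals.
Variables (R : realType) (nu0 : probability R R) (W sigma : R).
Hypothesis nu0_01 : nu0 `[0%R, 1%R]%classic = 1%E.
Hypotheses (W1 : 1 < W) (sigma0 : 0 < sigma).
Implicit Types (A B : set R) (c p : R) (i : nat).

Lemma tr_bB_tr_a p : tr_b W p - tr_a W p = W - 1.
Proof. by rewrite /tr_a /tr_b; ring. Qed.

Lemma tr_a_lt_tr_b p : tr_a W p < tr_b W p.
Proof. by rewrite -subr_gt0 tr_bB_tr_a subr_gt0. Qed.

Lemma tr_a_le0_le_tr_b p : 0 <= p <= 1 -> tr_a W p <= 0 <= tr_b W p.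
Proof.
by move=> /andP[p0 p1]; rewrite oppr_le0 !mulr_ge0// ?subr_ge0// ltW.
Qed.

Lemma nu_tilde_setT A : measurable A -> nu_tilde nu0 W sigma A setT = nu0 A.
Proof.
move=> mA; rewrite /nu_tilde; under eq_integral do rewrite trunc_normalT ?tr_a_lt_tr_b//.
by rewrite integral_cst//= mul1e.
Qed.

Lemma nu_tilde_le A B c : measurable A ->
    (forall p, A p -> trunc_normal sigma (tr_a W p) (tr_b W p) B <= c) ->
  (nu_tilde nu0 W sigma A B <= c%:E * nu0 A)%E.
Proof.
move=> mA trunc_le; rewrite -integral_cst//.
apply: ge0_le_integral_nonmeasurable => p Ap; rewrite lee_fin//=.
  exact: trunc_normal_ge0.
exact: trunc_le.
Qed.

Variable mu0 : probability (SeqSpace R) R.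
Hypothesis mu0P : is_product_measure nu0 W sigma mu0.

Lemma product_measure_coord i A B : measurable A -> measurable B ->
  mu0 [set x : SeqSpace R | A (x i).1 /\ B (x i).2] = nu_tilde nu0 W sigma A B.
Proof.
move=> mA mB; pose at_i (C : set R) j := if j == i then C else setT.
have m_at C j : measurable C -> measurable (at_i C j).
  by rewrite /at_i; case: ifP.
rewrite (_ : [set x | _] = [set x : SeqSpace R |
    forall j, (j < i.+1)%N ->
      at_i A j (x j).1 /\ at_i B j (x j).2]); last first.
  apply/seteqP; split => x /=; rewrite /at_i.
    by move=> xi j _; case: eqP => // ->.
  by move=> /(_ i (ltnSn i)); rewrite eqxx.
rewrite (mu0P i.+1 (fun j => conj (m_at A j mA) (m_at B j mB))).
rewrite big_ord_recr/= /at_i eqxx big1 ?mul1e// => j _.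
by rewrite (ltn_eqF (ltn_ord j)) nu_tilde_setT// probability_setT.
Qed.

Lemma product_measure_judge i A : measurable A ->
  mu0 [set x : SeqSpace R | A (x i).1] = nu0 A.
Proof.
move=> mA; rewrite -nu_tilde_setT// -(product_measure_coord i)//.
by congr (mu0 _); apply/seteqP; split => x //= [].
Qed.

Lemma product_measure_noise_le i B c : measurable B ->
    (forall p, 0 <= p <= 1 ->
      trunc_normal sigma (tr_a W p) (tr_b W p) B <= c) ->
  (mu0 [set x : SeqSpace R | B (x i).2] <= c%:E)%E.
Proof.
move=> mB trunc_le; pose I01 : set R := `[0%R, 1%R]%classic.
have mI : measurable I01 by exact: measurable_itv.
have mIC := measurableC mI.
have mIB := measurable_rectangle i mI mB.
have mJ := measurable_judge_event i mIC.
apply: (@le_trans _ _ (mu0 ([set x : SeqSpace R | I01 (x i).1 /\ B (x i).2]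
    `|` [set x : SeqSpace R | (~` I01) (x i).1]))).
  apply: le_measure; rewrite ?inE.
  - exact: measurable_noise_event.
  - exact: measurableU.
  - by move=> x Bx; have [Ix|Ix] := pselect (I01 (x i).1); [left|right].
apply: (le_trans (measureU2 _ mIB mJ)).
rewrite [X in (_ + X)%E](product_measure_judge i mIC).
rewrite probability_setC// nu0_01 subee// adde0.
rewrite [leLHS](product_measure_coord i mI mB).
apply: (le_trans (nu_tilde_le (c := c) mI _)); last by rewrite nu0_01 mule1.
by move=> p; rewrite /I01/= in_itv; exact: trunc_le.
Qed.

Lemma ae_voter_range : {ae mu0, forall x : SeqSpace R,
  forall i, 0 <= (x i).1 <= 1 /\ `|(x i).2| <= W - 1}.
Proof.
apply: ae_foralln => i.
have mIC := measurableC (measurable_itv `[0%R : R, 1%R]).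
have mtail := @measurable_norm_tail R (W - 1).
pose judge_out := [set x : SeqSpace R | (~` `[0%R, 1%R]%classic) (x i).1].
pose noise_out := [set x : SeqSpace R | norm_tail (W - 1) (x i).2].
have judge_null : mu0 judge_out = 0%E.
  by rewrite product_measure_judge// probability_setC// nu0_01 subee.
have noise_null : mu0 noise_out = 0%E.
  apply/eqP; rewrite -measure_le0; apply: product_measure_noise_le => // p p01.
  rewrite trunc_normal_disjoint//; apply/seteqP; split => z //= [].
  have /andP[a0 b0] := tr_a_le0_le_tr_b p01; have := tr_bB_tr_a p.
  rewrite /norm_tail/= in_itv/= => ba + /andP[az zb].
  by rewrite ltNge => /negP; apply; rewrite ler_norml; lra.
have mjudge : measurable judge_out by exact: measurable_judge_event.
have mnoise : measurable noise_out by exact: measurable_noise_event.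
exists (judge_out `|` noise_out); split; first exact: measurableU.
  by rewrite measureU0.
move=> x /= out_of_range; apply: contrapT => /not_orP[/contrapT + /negP].
by rewrite /= in_itv/= -leNgt => p01 e_le; exact: out_of_range.
Qed.

Lemma iid_product_labels (J1 J2 : finType) (phi : R -> J1) (psi : R -> J2) :
    measurable_fibers phi -> measurable_fibers psi ->
  iid mu0 (fun i (x : SeqSpace R) => (phi (x i).1, psi (x i).2)).
Proof.
move=> mphi mpsi n f.
have pairE i (j : J1 * J2) :
    (fun x : SeqSpace R => (phi (x i).1, psi (x i).2)) @^-1` [set j]
    = [set x | (phi @^-1` [set j.1]) (x i).1 /\ (psi @^-1` [set j.2]) (x i).2].
  by case: j => a b; apply/seteqP; split => x /=; [case|case=> -> ->].
under eq_bigr do rewrite pairE product_measure_coord//.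
rewrite -(mu0P n (A := fun i => phi @^-1` [set (f i).1])
  (B := fun i => psi @^-1` [set (f i).2]))//.
congr (mu0 _); apply/seteqP; split => x /= Zf i i_lt.
  by rewrite -Zf.
by have [-> ->] := Zf i i_lt; case: (f i).
Qed.

End product_marginals.

Section drift.
Variable R : realType.
Implicit Types (W h p : R) (k : nat) (pe : R * R).

Lemma power_drift_ge h p k : 2^-1 <= h -> 0 <= p <= 1 ->
  (2 * h - 1) * h ^+ k * (h <= p)%R%:R - 2^-1 ^+ k <= p ^+ k * (2 * p - 1).
Proof.
move=> h2 /andP[p0 p1]; set K := 2^-1 ^+ k.
have K0 : 0 <= K by rewrite exprn_ge0 ?invr_ge0.
have pk0 : 0 <= p ^+ k by rewrite exprn_ge0.
case: (leP h p) => hp; rewrite ?mulr1 ?mulr0.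
  have : (2 * h - 1) * h ^+ k <= (2 * p - 1) * p ^+ k.
    by rewrite ler_pM ?exprn_ge0 ?lerXn2r ?nnegrE//; lra.
  by rewrite (mulrC (p ^+ k)); lra.
have [p2|p2] := leP 2^-1 p.
  by apply: (@le_trans _ _ 0); [lra|rewrite mulr_ge0//; lra].
have pkK : p ^+ k <= K by rewrite lerXn2r ?nnegrE ?invr_ge0// ltW.
have : p ^+ k * (1 - 2 * p) <= p ^+ k by rewrite ler_piMr//; lra.
lra.
Qed.

Definition noise_threshold W k : R := 2^-1 ^+ k * (W - 1).

Definition voter_label W h k pe : bool * bool :=
  (h <= pe.1, noise_threshold W k < `|pe.2|).

Definition label_drift W h k (j : bool * bool) : R :=
  (W - 1) * ((2 * h - 1) * h ^+ k * j.1%:R - j.2%:R - 2 * 2^-1 ^+ k) - 1.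

Lemma label_drift_le_weight W h k pe : 1 < W -> 2^-1 <= h ->
    0 <= pe.1 <= 1 -> `|pe.2| <= W - 1 ->
  label_drift W h k (voter_label W h k pe) <= weight W k pe * (2 * pe.1 - 1).
Proof.
case: pe => p e W1 h2 /= p01 eW.
rewrite /label_drift /noise_threshold /weight /=.
have := power_drift_ge k h2 p01; have /andP[p0 p1] := p01.
set D := W - 1 in eW *; have D0 : 0 < D by rewrite subr_gt0.
set K := 2^-1 ^+ k; set S := _ * _%:R => skill.
have {}skill : D * (S - K) <= D * (p ^+ k * (2 * p - 1)) by rewrite ler_pM2l.
have noise : - (K * D) - D * (K * D < `|e|)%R%:R <= e * (2 * p - 1).
  have KD0 : 0 <= K * D by rewrite mulr_ge0 ?exprn_ge0 ?invr_ge0// ltW.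
  have : `|e * (2 * p - 1)| <= `|e| by rewrite normrM ler_piMr// ler_norml; lra.
  by rewrite ler_norml => /andP[]; case: ltP; rewrite ?mulr1 ?mulr0; lra.
lra.
Qed.

Lemma normr_weight_le2W W k pe : 1 < W -> 0 <= pe.1 <= 1 -> `|pe.2| <= W - 1 ->
  `|weight W k pe| <= 2 * W.
Proof.
case: pe => p e W1 /= /andP[p0 p1].
rewrite /weight/= !ler_norml => /andP[e_ge e_le].
have : 0 <= (W - 1) * p ^+ k <= W - 1.
  by rewrite mulr_ge0 ?exprn_ge0 ?ler_piMr ?exprn_ile1//; lra.
by case/andP => ? ?; lra.
Qed.

Lemma label_drift_le2W W h k j : 1 < W -> 2^-1 <= h <= 1 ->
  label_drift W h k j <= 2 * W.
Proof.
move=> W1 /andP[h2 h1]; rewrite /label_drift.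
set S := _ * _%:R; set K := 2^-1 ^+ k.
have S1 : S <= 1.
  have hk : 0 <= h ^+ k <= 1 by rewrite exprn_ge0 ?exprn_ile1//; lra.
  rewrite /S; case: j.1; rewrite ?mulr0// mulr1 mulr_ile1//; lra.
have K0 : 0 <= K by rewrite exprn_ge0 ?invr_ge0.
have : (W - 1) * (S - j.2%:R - 2 * K) <= (W - 1) * 1.
  by rewrite ler_pM2l ?subr_gt0//; case: j.2 => /=; lra.
lra.
Qed.

End drift.

Section jury.
Variables (R : realType) (nu0 : probability R R) (W sigma h : R) (k : nat).
Variable mu0 : probability (SeqSpace R) R.
Hypothesis nu0_01 : nu0 `[0%R, 1%R]%classic = 1%E.
Hypotheses (W1 : 1 < W) (sigma0 : 0 < sigma).
Hypothesis mu0P : is_product_measure nu0 W sigma mu0.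

Let label i (x : SeqSpace R) := voter_label W h k (x i).

Let measurable_high : measurable_fibers (fun p : R => h <= p).
Proof.
by apply: measurable_fibers_bool; exact: measurable_fun_ler.
Qed.

Let measurable_far :
  measurable_fibers (fun e : R => noise_threshold W k < `|e|).
Proof.
by apply: measurable_fibers_bool; exact: measurable_fun_ltr.
Qed.

Lemma iid_voter_label : iid mu0 label.
Proof.
exact: (iid_product_labels W1 sigma0 mu0P measurable_high measurable_far).
Qed.

Lemma measurable_fibers_voter_label i : measurable_fibers (label i).
Proof.
move=> [a b]; rewrite (_ : _ @^-1` _ = [set x : SeqSpace R |
    ((fun p => h <= p) @^-1` [set a]) (x i).1 /\
    ((fun e => noise_threshold W k < `|e|) @^-1` [set b]) (x i).2]).
  exact: measurable_rectangle.
by apply/seteqP; split => x /=; [case|case=> <- <-].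
Qed.

Lemma noise_tail_le : 4 / (2^-1 ^+ k) ^+ 2 <= (W - 1) / sigma ->
  (mu0 [set x : SeqSpace R | norm_tail (noise_threshold W k) (x 0%N).2]
   <= (2^-1 ^+ k)%:E)%E.
Proof.
move=> large; apply: (product_measure_noise_le nu0_01 W1 sigma0 mu0P).
  exact: measurable_norm_tail.
move=> p p01; rewrite /noise_threshold -(tr_bB_tr_a W p).
apply: trunc_normal_relative_tail_le => //.
- exact: tr_a_le0_le_tr_b.
- exact: tr_a_lt_tr_b.
- by rewrite exprn_gt0 ?invr_gt0// exprn_ile1 ?invr_ge0// invf_le1// ler1n.
- by rewrite tr_bB_tr_a.
Qed.

Lemma mean_label_drift :
  \sum_j label_drift W h k j * law mu0 (label 0%N) j
  = (W - 1) * ((2 * h - 1) * h ^+ k * fine (nu0 `[h, +oo[%classic)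
      - fine (mu0 [set x : SeqSpace R |
                     norm_tail (noise_threshold W k) (x 0%N).2])
      - 2 * 2^-1 ^+ k) - 1.
Proof.
have mlabel := measurable_fibers_voter_label 0.
have highE :
    \sum_(j | j.1) law mu0 (label 0%N) j = fine (nu0 `[h, +oo[%classic).
  rewrite (sum_law_pred mu0 (fun j => j.1) mlabel).
  rewrite -(product_measure_judge W1 sigma0 mu0P 0)//.
  by congr (fine (mu0 _)); apply/seteqP; split => x /=; rewrite in_itv/= andbT.
have farE := sum_law_pred mu0 (fun j => j.2) mlabel.
pose v j := law mu0 (label 0%N) j; rewrite -highE -farE (eq_bigr (fun j =>
    (W - 1) * ((2 * h - 1) * h ^+ k) * (if j.1 then v j else 0)
    - (W - 1) * (if j.2 then v j else 0)
    - ((W - 1) * (2 * 2^-1 ^+ k) + 1) * v j)).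
  by rewrite !sumrB -!mulr_sumr -!big_mkcond sum_law//; ring.
by move=> [[] []] _; rewrite /label_drift/= -/(v _); ring.
Qed.

Lemma mean_label_drift_gt0 :
    4 <= (2 * h) ^+ k * ((2 * h - 1) * fine (nu0 `[h, +oo[%classic)) ->
    4 / (2^-1 ^+ k) ^+ 2 <= W - 1 ->
    4 / (2^-1 ^+ k) ^+ 2 <= (W - 1) / sigma ->
  0 < \sum_j label_drift W h k j * law mu0 (label 0%N) j.
Proof.
move=> skill_large W_large ratio_large; rewrite mean_label_drift.
set K := 2^-1 ^+ k; set q := fine (nu0 _); set far := fine _; set D := W - 1.
have K0 : 0 < K by rewrite exprn_gt0 ?invr_gt0.
have K1 : K <= 1 by rewrite exprn_ile1 ?invr_ge0// invf_le1// ler1n.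
have D0 : 0 < D by rewrite subr_gt0.
have far_le : far <= K.
  rewrite -lee_fin fineK; first exact: noise_tail_le.
  apply: fin_num_measure; apply: measurable_noise_event.
  exact: measurable_norm_tail.
have skill_ge : 4 * K <= (2 * h - 1) * h ^+ k * q.
  have -> : (2 * h - 1) * h ^+ k * q = (2 * h) ^+ k * ((2 * h - 1) * q) * K.
    by rewrite exprMn /K exprVn; field; rewrite expf_neq0.
  by rewrite ler_pM2r.
have DK : 4 <= D * K.
  move: W_large; rewrite ler_pdivrMr ?exprn_gt0// expr2 mulrA.
  by move/le_trans; apply; rewrite ler_piMr// mulr_ge0// ltW.
have : D * K <= D * ((2 * h - 1) * h ^+ k * q - far - 2 * K).
  by rewrite ler_pM2l//; lra.
lra.
Qed.

Lemma CJP_set_ae : 2^-1 < h <= 1 ->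
    4 <= (2 * h) ^+ k * ((2 * h - 1) * fine (nu0 `[h, +oo[%classic)) ->
    4 / (2^-1 ^+ k) ^+ 2 <= W - 1 ->
    4 / (2^-1 ^+ k) ^+ 2 <= (W - 1) / sigma ->
  {ae mu0, forall x : SeqSpace R, CJP_set W k x}.
Proof.
move=> /andP[h2 h1] skill_large W_large ratio_large.
apply: (ae_vote_prob_cvg1 (Z := label) (drift := label_drift W h k)
  (x := fun x => x) (M := 2 * W)).
- exact: measurable_fibers_voter_label.
- exact: iid_voter_label.
- by move=> j; apply: label_drift_le2W; rewrite ?(ltW h2).
- apply: filterS (ae_voter_range nu0_01 W1 sigma0 mu0P) => x range i.
  have [p01 e_le] := range i; split=> //; first exact: normr_weight_le2W.
  by apply: label_drift_le_weight => //; exact: ltW.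
- exact: mean_label_drift_gt0.
Qed.

End jury.

Theorem theorem3 (R : realType) (nu0 : probability R R) :
  nu0 `[0%R, 1%R]%classic = 1%E ->
  (0 < nu0 (`](2^-1)%R, 1%R]%classic : set R))%E ->
  exists k : nat, (0 < k)%N /\
    exists T : R, forall W sigma : R,
      1 < W -> 0 < sigma -> T <= W -> T <= (W - 1) / sigma ->
      forall mu0 mu : probability (SeqSpace R) R,
        is_product_measure nu0 W sigma mu0 ->
        mu `<< mu0 ->
        mu (CJP_set W k) = 1%E.
Proof.
move=> nu0_01 /measure_itv_oc_gt0[h /andP[h2 h1] nu0_h].
set q := fine (nu0 `[h, +oo[%classic).
have h2_gt1 : 1 < 2 * h by lra.
have q0 : 0 < (2 * h - 1) * q.
  by rewrite mulr_gt0 ?fine_gt0 ?nu0_h/= ?ltey_eq ?fin_num_measure//; lra.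
have [k k0 k_large] := expr_unbounded (4 / ((2 * h - 1) * q)) h2_gt1.
exists k; split => //; exists (1 + 4 / (2^-1 ^+ k) ^+ 2).
move=> W sigma W1 sigma0 W_large ratio_large mu0 mu mu0P mu_mu0.
have mCJP := @measurable_CJP_set R W k.
have CJP_ae : {ae mu0, forall x : SeqSpace R, CJP_set W k x}.
  apply: (CJP_set_ae (h := h) nu0_01 W1 sigma0 mu0P); rewrite ?h2//.
  - by rewrite -ler_pdivrMr.
  - lra.
  - lra.
have mu_C : mu (~` CJP_set W k) = 0%E.
  exact: (mu_mu0 _ (negligible_null_set CJP_ae) _ (measurableC mCJP)).
rewrite -[CJP_set W k]setCK probability_setC; last exact: measurableC.
by rewrite mu_C sube0.
Qed.
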